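(* Let $\mathbf{k}$ be a field of characteristic zero, let $A=\mathbf{k}[z;1,\eta,\varphi(z)]$ with $\eta\neq0$, and let $F_1$ be the Hochschild $2$-cocycle corresponding to $f(1)$. There exists a unique family of $\mathbf{k}$-bilinear maps $F_n\colon A\times A\to A$, $n\geq2$, integrating $F_1$, such that each $F_n$ satisfies, for all $u,v\in A$, (a) $F_n(u,1)=F_n(1,v)=0$; (b) $F_n(zu,v)=zF_n(u,v)$, and $F_n(x^q,x^j)=F_n(y^q,y^j)=0$ for all $q,j$; and which are determined by $$F_n(x,z)=0,\quad F_n(y,z)=0,\quad F_n(x,y)=\frac{(-1)^n}{n!}\bar\varphi^{(n)}(z),\quad F_n(y,x)=0\qquad(n\ge2).$$ Moreover, the $F_n$ preserve $\Gamma$.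
   Context: Let $\eta\in\mathbf{k}$, $0\neq\varphi(z)\in\mathbf{k}[z]$ of degree $l$, and $\sigma$ the automorphism of $\mathbf{k}[z]$ with $\sigma(z)=z+\eta$. The algebra $A=\mathbf{k}[z;1,\eta,\varphi(z)]$ is generated by $x,y,z$ subject to $xz=(z+\eta)x$, $yz=(z-\eta)y$, $yx=\varphi(z)$, $xy=\sigma(\varphi(z))$. Write $\bar\varphi(z)=\sigma(\varphi(z))=\varphi(z+\eta)$; $\bar\varphi^{(n)}$ is its $n$-th derivative. For bilinear $F\colon A\times A\to A$, $\mathsf{b}F(a_1,a_2,a_3)=a_1F(a_2,a_3)-F(a_1a_2,a_3)+F(a_1,a_2a_3)-F(a_1,a_2)a_3$; $F$ is a Hochschild $2$-cocycle if $\mathsf{b}F=0$. Put $F\bullet G(a_1,a_2,a_3)=F(G(a_1,a_2),a_3)-F(a_1,G(a_2,a_3))$. Maps $F_2,F_3,\dots$ integrate $F_1$ if $\sum_{i=1}^{n-1}F_i\bullet F_{n-i}=\mathsf{b}F_n$ for all $n\ge2$. For $m\in A$, $f(m)=(mx,-ym,0,-{}^\sigma\Delta^\sigma(\varphi)\cdot m)\in A^{\oplus4}$, where for $\varphi=\sum_ia_iz^i$, ${}^\sigma\Delta^\sigma(\varphi)\cdot m=\sum_{i\ge1}a_i\sum_{j=1}^i\sigma(z)^{i-j}m\sigma(z)^{j-1}$; it is a $2$-cocycle in a periodic complex computing Hochschild cohomology. The Hochschild $2$-cocycle $F_1$ corresponding to $f(1)$ (via an explicit comparison with the bar resolution) is,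 concretely, the unique Hochschild $2$-cocycle satisfying (a), (b) (with $F_1$ in place of $F_n$) and $F_1(x,z)=-x$, $F_1(y,z)=y$, $F_1(x,y)=-\bar\varphi'(z)$, $F_1(y,x)=0$. Filtration $\Gamma$: let $x_q=x^q$ for $q\ge0$ and $x_q=y^{-q}$ for $q<0$; $\mathcal{B}=\{z^px_q\mid p\ge0,q\in\mathbb{Z}\}$ is a basis of $A$. Put $\|z^px_q\|=p+(l+1)|q|$ and $\Gamma^nA=\operatorname{span}_{\mathbf{k}}\{b\in\mathcal{B}:\|b\|\le n\}$. A bilinear map $F$ preserves $\Gamma$ if $F(b_1,b_2)\in\Gamma^{\|b_1\|+\|b_2\|}A$ for all $b_1,b_2\in\mathcal{B}$. *)

(* Defs.v *)
From HB Require Import structures.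
From mathcomp Require Import all_boot all_order all_algebra.

Set Implicit Arguments.
Unset Strict Implicit.
Unset Printing Implicit Defensive.

Import GRing.Theory.
Local Open Scope ring_scope.

Section GeneralizedWeylAlgebra.
Variables (k : fieldType) (eta : k) (phi : {poly k}).

Definition sigma (p : {poly k}) : {poly k} := p \Po ('X + eta%:P).

(* For a polynomial p, [horner_alg z p] is p(z), computed in the algebra. *)
Definition gwa_relations (B : algType k) (x y z : B) : Prop :=
  [/\ x * z = (z + eta%:A) * x,
      y * z = (z - eta%:A) * y,
      y * x = horner_alg z phi
    & x * y = horner_alg z (sigma phi)].

(* A is the algebra generated by x, y, z subject to [gwa_relations],
   expressed by the universal property of the presentation. *)
Definition is_gwa (A : algType k) (x y z : A) : Prop :=
  gwa_relations x y z /\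
  forall (B : algType k) (x' y' z' : B), gwa_relations x' y' z' ->
    exists f : {lrmorphism A -> B},
      [/\ f x = x', f y = y' & f z = z'] /\
      forall g : {lrmorphism A -> B},
        [/\ g x = x', g y = y' & g z = z'] -> g =1 f.

End GeneralizedWeylAlgebra.

Section HochschildCochains.
Variables (k : fieldType) (A : algType k).
Implicit Types F G : A -> A -> A.

Definition hochschild_b F (a1 a2 a3 : A) : A :=
  a1 * F a2 a3 - F (a1 * a2) a3 + F a1 (a2 * a3) - F a1 a2 * a3.

Definition hochschild_cocycle2 F : Prop :=
  forall a1 a2 a3, hochschild_b F a1 a2 a3 = 0.

Definition bullet F G (a1 a2 a3 : A) : A :=
  F (G a1 a2) a3 - F a1 (G a2 a3).

(* Only the values of F at indices n >= 1 matter; F 1 is the given F1. *)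
Definition integrates (F1 : {bilinear A -> A -> A})
    (F : nat -> {bilinear A -> A -> A}) : Prop :=
  (forall u v, F 1%N u v = F1 u v) /\
  forall n, (2 <= n)%N -> forall a1 a2 a3,
    \sum_(1 <= i < n) bullet (F i) (F (n - i)%N) a1 a2 a3
    = hochschild_b (F n) a1 a2 a3.

End HochschildCochains.

Section Conditions.
Variables (k : fieldType) (eta : k) (phi : {poly k}) (A : algType k).
Variables (x y z : A).

Definition cond_a (F : A -> A -> A) : Prop :=
  forall u v, F u 1 = 0 /\ F 1 v = 0.

Definition cond_b (F : A -> A -> A) : Prop :=
  (forall u v, F (z * u) v = z * F u v) /\
  (forall q j : nat, F (x ^+ q) (x ^+ j) = 0 /\ F (y ^+ q) (y ^+ j) = 0).

(* The Hochschild 2-cocycle corresponding to f(1) = (x, -y, 0, -(sigma phi)'). *)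
Definition is_F1 (F1 : {bilinear A -> A -> A}) : Prop :=
  [/\ hochschild_cocycle2 F1, cond_a F1, cond_b F1
    & [/\ F1 x z = - x,
          F1 y z = y,
          F1 x y = - horner_alg z (sigma eta phi)^`()
        & F1 y x = 0]].

Definition generator_values (n : nat) (F : A -> A -> A) : Prop :=
  [/\ F x z = 0,
      F y z = 0,
      F x y = ((-1) ^+ n / n`!%:R) *: horner_alg z (sigma eta phi)^`(n)
    & F y x = 0].

Definition integrating_family (F1 : {bilinear A -> A -> A})
    (F : nat -> {bilinear A -> A -> A}) : Prop :=
  integrates F1 F /\
  forall n, (2 <= n)%N ->
    [/\ cond_a (F n), cond_b (F n) & generator_values n (F n)].

Definition xpow (q : int) : A :=
  match q with Posz m => x ^+ m | Negz m => y ^+ m.+1 end.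

(* Elements of the basis are indexed by their exponents (p, q). *)
Definition basis_elt (b : nat * int) : A := z ^+ b.1 * xpow b.2.

(* (size phi).-1 is the degree l of phi, so (size phi).-1.+1 is l + 1. *)
Definition basis_norm (b : nat * int) : nat :=
  (b.1 + (size phi).-1.+1 * `|b.2|)%N.

Definition Gamma (n : nat) (a : A) : Prop :=
  exists (s : seq (nat * int)) (c : nat * int -> k),
    (forall b, b \in s -> (basis_norm b <= n)%N) /\
    a = \sum_(b <- s) c b *: basis_elt b.

Definition preserves_Gamma (F : A -> A -> A) : Prop :=
  forall b1 b2 : nat * int,
    Gamma (basis_norm b1 + basis_norm b2)%N (F (basis_elt b1) (basis_elt b2)).

End Conditions.

(* Main.v *)
Require Import Defs.
From HB Require Import structures.
From mathcomp Require Import all_boot all_order all_algebra.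
From mathcomp Require Import finmap zify.
From mathcomp.multinomials Require Import monalg.

Set Implicit Arguments.
Unset Strict Implicit.
Unset Printing Implicit Defensive.

Import Order.TTheory GRing.Theory Num.Theory.
Local Open Scope ring_scope.

(** Integrating F_1 amounts to finding an associative product
      u * v = u v + t F_1(u, v) + t^2 F_2(u, v) + ...
    on A[[t]].  By the prescribed values on the generators, and because the
    F_n are left k[z]-linear and vanish on powers of x and on powers of y,
    such a product satisfies
      x * z = (z + eta - t) x,        y * z = (z - eta + t) y,
      y * x = phi(z),                 x * y = phi(z + eta - t),
    where the last value is the Taylor expansion of phi(z + eta) at step -t.
    These are the relations of A with eta replaced by eta - t.  So the F_n
    must be the coefficients of t^n in the product of the generalized Weyl
    algebra of parameter eta - t, written in the basis z^p x_q.

    To turn this into a construction, a generalized Weyl algebra [gwa] is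
    built over any domain K, with any parameter h in K, as the free left
    K[z]-module on the x_q, q an integer, with product
      (a x_q) (b x_r) = a tau_q(b) P(q, r) x_(q+r),   tau_q(b)(z) = b(z + q h),
    where the polynomial P(q, r) is [twist].  Associativity is a cocycle
    identity for P ([twist_cocycle]); it holds because P is the coboundary of
    a family of nonzero polynomials ([weightD]).  Over K = k, h = eta this
    algebra is isomorphic to A ([gwa_iso]), by the universal property of the
    presentation.  Over K = k[t], h = eta - t it carries the deformed product,
    no completion being needed since products of basis elements are polynomial
    in t.  Extracting the coefficient of t^n gives [star n].  Comparing
    coefficients in the associative law yields the integration equations
    ([star_cobound]), and the remaining requirements are read off on basis
    elements ([model_family]).  The degree in z of P(q, r) is at most
    l (|q| + |r| - |q + r|), whence the compatibility with Gamma
    ([star_Gamma]).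

    Uniqueness, and the identification of the coefficient of t with the given
    F_1, both follow from [cochain_unique]: two bilinear maps with the same
    coboundary which satisfy (a) and (b) coincide as soon as they agree on
    (x, z), (y, z), (x, y) and (y, x).  By induction on n the coboundary of
    F_n is determined by F_1, ..., F_(n-1). *)

(** * Additive maps on finitely supported families *)

Section Extension.
Variables (I : choiceType) (G V : zmodType).

(** The additive map on the direct sum of copies of [G] induced by a family of
    additive maps. *)
Definition extend (f : I -> G -> V) (u : {malg G[I]}) : V :=
  \sum_(i <- msupp u) f i u@_i.

Variable f : I -> G -> V.
Hypothesis fD : forall i, {morph f i : a b / a + b}.

Let f0 i : f i 0 = 0.
Proof. by apply: (addIr (f i 0)); rewrite -fD !add0r. Qed.

Lemma extend_widen (D : {fset I}) u :
  (msupp u `<=` D)%fset -> extend f u = \sum_(i <- D) f i u@_i.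
Proof.
move=> le; rewrite [LHS](big_fset_incl _ le) => //= i _ /mcoeff_outdom ->.
exact: f0.
Qed.

Lemma extendU i a : extend f << a *g i >> = f i a.
Proof. by rewrite (extend_widen msuppU_le) big_seq_fset1 mcoeffUU. Qed.

Lemma extendD : {morph extend f : u v / u + v}.
Proof.
move=> u v; pose D := (msupp u `|` msupp v)%fset.
rewrite (extend_widen (msuppD_le u v)) (@extend_widen D u) ?fsubsetUl//.
rewrite (@extend_widen D v) ?fsubsetUr// -big_split /=.
by apply: eq_bigr => i _; rewrite mcoeffD fD.
Qed.

End Extension.

Lemma malg_ind (I : choiceType) (G : zmodType) (Q : {malg G[I]} -> Prop) :
  Q 0 -> (forall u v, Q u -> Q v -> Q (u + v)) ->
  (forall i a, Q << a *g i >>) -> forall u, Q u.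
Proof.
move=> Q0 QD QU u; rewrite [u]monalgE.
by elim/big_ind: _ => // i _; apply: QU.
Qed.

Lemma malg_morph_eq (I : choiceType) (G V : zmodType)
    (F1 F2 : {malg G[I]} -> V) :
  {morph F1 : u v / u + v} -> {morph F2 : u v / u + v} ->
  (forall i a, F1 << a *g i >> = F2 << a *g i >>) -> F1 =1 F2.
Proof.
move=> D1 D2 E; elim/malg_ind => //.
- have z (F : {malg G[I]} -> V) : {morph F : u v / u + v} -> F 0 = 0.
    by move=> D; apply: (addIr (F 0)); rewrite -D !add0r.
  by rewrite !z.
- by move=> u v Eu Ev; rewrite D1 D2 Eu Ev.
Qed.

(** * Structure constants of the basis x_q *)

Section Model.
Variables (K : idomainType) (h : K) (phi : {poly K}).
Implicit Types (q r s : int) (p : {poly K}).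

(** Left multiplication by x_q commutes past a polynomial in z at the cost of
    this shift: x_q p(z) = p(z + q h) x_q. *)
Definition tau q p : {poly K} := p \Po ('X + (h *~ q)%:P).
HB.instance Definition _ q :=
  GRing.RMorphism.copy (tau q) (comp_poly ('X + (h *~ q)%:P)).

Lemma tau0 p : tau 0 p = p.
Proof. by rewrite /tau mulr0z addr0 comp_polyXr. Qed.

Lemma tau_tau q r p : tau q (tau r p) = tau (q + r) p.
Proof.
rewrite /tau -comp_polyA comp_polyD comp_polyX comp_polyC.
by rewrite mulrzDr polyCD addrA.
Qed.

Lemma tauX q : tau q 'X = 'X + (h *~ q)%:P.
Proof. by rewrite /tau comp_polyX. Qed.

Lemma tauZ q a p : tau q (a *: p) = a *: tau q p.
Proof. exact: comp_polyZ. Qed.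

Lemma size_tau q p : size (tau q p) = size p.
Proof. by rewrite size_comp_poly2 // size_XaddC. Qed.

Lemma tau_eq0 q p : (tau q p == 0) = (p == 0).
Proof. by rewrite -!size_poly_eq0 size_tau. Qed.

(** The factors in x x_r = xstep r x_(r+1) and y x_r = ystep r x_(r-1): a
    generator meeting its opposite is absorbed into phi. *)
Definition xstep r : {poly K} := if r < 0 then tau 1 phi else 1.
Definition ystep r : {poly K} := if 0 < r then phi else 1.

Lemma xstep1 r : 0 <= r -> xstep r = 1.
Proof. by rewrite /xstep ltNge => ->. Qed.

Lemma ystep1 r : r <= 0 -> ystep r = 1.
Proof. by rewrite /ystep ltNge => ->. Qed.

Fixpoint xtwist (m : nat) r : {poly K} :=
  if m is n.+1 then tau 1 (xtwist n r) * xstep (n%:Z + r) else 1.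
Fixpoint ytwist (m : nat) r : {poly K} :=
  if m is n.+1 then tau (-1) (ytwist n r) * ystep (r - n%:Z) else 1.

(** The polynomial P(q, r) for which x_q x_r = P(q, r) x_(q+r). *)
Definition twist q r : {poly K} :=
  match q with Posz m => xtwist m r | Negz m => ytwist m.+1 r end.

Lemma twist0 r : twist 0 r = 1. Proof. by []. Qed.

(** Inside the skew Laurent ring K[z][X, 1/X; tau] one may take x = X and
    y = phi / X; then x_q is [weight q] times X^q. *)
Fixpoint yweight (m : nat) : {poly K} :=
  if m is n.+1 then phi * tau (-1) (yweight n) else 1.
Definition weight q : {poly K} :=
  match q with Posz _ => 1 | Negz m => yweight m.+1 end.

Lemma ystep_weight r : phi * tau (-1) (weight r) = ystep r * weight (r - 1).
Proof.
rewrite /ystep; case: r => [[|r]|r].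
- by rewrite /= mul1r.
- by rewrite (_ : r.+1%:Z - 1 = r) /= ?rmorph1; last lia.
- by rewrite (_ : Negz r - 1 = Negz r.+1) /= ?mul1r; last lia.
Qed.

Lemma xstep_weight r : tau 1 (weight r) = xstep r * weight (r + 1).
Proof.
rewrite /xstep; case: r => r.
  by rewrite (_ : r%:Z + 1 = r.+1) /= ?rmorph1 ?mul1r; last lia.
rewrite [weight _]/= rmorphM /= tau_tau subrr tau0; congr (_ * _).
have -> : Negz r + 1 = - r%:Z by lia.
by case: r => [|r]; rewrite ?oppr0 // -NegzE.
Qed.

(** Comparing the two expansions of x_q x_r in the skew Laurent ring shows that
    [twist] is the multiplicative coboundary of [weight]. *)
Lemma weightD q r : weight q * tau q (weight r) = twist q r * weight (q + r).
Proof.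
have xP m : tau m%:Z (weight r) = xtwist m r * weight (m%:Z + r).
  elim: m => [|m IH] /=; first by rewrite tau0 mul1r add0r.
  have -> : m.+1%:Z = 1 + m%:Z by lia.
  rewrite -tau_tau IH rmorphM /= xstep_weight mulrA; congr (_ * weight _); lia.
have yP m : yweight m * tau (- m%:Z) (weight r) = ytwist m r * weight (r - m%:Z).
  elim: m => [|m IH] /=; first by rewrite oppr0 tau0 subr0.
  have -> : - m.+1%:Z = -1 - m%:Z by lia.
  rewrite -tau_tau -mulrA -rmorphM /= IH rmorphM /= mulrCA ystep_weight mulrA.
  congr (_ * weight _); lia.
case: q => m; first by rewrite mul1r xP.
by rewrite NegzE [_ + r]addrC -yP.
Qed.

Lemma twistx0 q : twist q 0 = 1.
Proof.
case: q => m; rewrite /twist.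
  by elim: m => //= m ->; rewrite rmorph1 xstep1 ?mulr1 //; lia.
by elim: m.+1 => //= n ->; rewrite rmorph1 ystep1 ?mulr1 //; lia.
Qed.

Lemma twist_pos (m n : nat) : twist m n = 1.
Proof.
by rewrite /=; elim: m => //= m ->; rewrite rmorph1 xstep1 ?mulr1 //; lia.
Qed.

Lemma twist_neg (m n : nat) : twist (- m%:Z) (- n%:Z) = 1.
Proof.
have H i : ytwist i (- n%:Z) = 1.
  by elim: i => //= i ->; rewrite rmorph1 ystep1 ?mulr1 //; lia.
by case: m => [|m]; rewrite ?oppr0 // -NegzE; apply: H.
Qed.

(** Each absorption of a pair x, y into phi lowers the total exponent by two
    and costs the degree of phi. *)
Lemma size_twist q r :
  (size (twist q r) <= ((size phi).-1 * (`|q| + `|r| - `|(q + r)%R|)).+1)%N.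
Proof.
have sz (a b : {poly K}) (d e f : nat) : (size a <= (e * d).+1 ->
    size b <= (e * f).+1 -> size (a * b)%R <= (e * (d + f)).+1)%N.
  by move=> Ha Hb; apply: leq_trans (size_polyMleq _ _) _; lia.
have xP m : (size (xtwist m r)
    <= ((size phi).-1 * (m + `|r| - `|(m%:Z + r)%R|)).+1)%N.
  elim: m => [|m IH] /=; first by rewrite size_poly1.
  rewrite /xstep; case: ltP => H.
    have -> : (m.+1 + `|r| - `|(m.+1%:Z + r)%R|
             = (m + `|r| - `|(m%:Z + r)%R|) + 2)%N by lia.
    by apply: sz; rewrite size_tau //; move: (size phi); lia.
  rewrite mulr1 size_tau.
  by have -> : (m.+1 + `|r| - `|(m.+1%:Z + r)%R|
             = m + `|r| - `|(m%:Z + r)%R|)%N by lia.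
have yP m : (size (ytwist m r)
    <= ((size phi).-1 * (m + `|r| - `|(r - m%:Z)%R|)).+1)%N.
  elim: m => [|m IH] /=; first by rewrite size_poly1.
  rewrite /ystep; case: ltP => H.
    have -> : (m.+1 + `|r| - `|(r - m.+1%:Z)%R|
             = (m + `|r| - `|(r - m%:Z)%R|) + 2)%N by lia.
    by apply: sz; rewrite ?size_tau //; move: (size phi); lia.
  rewrite mulr1 size_tau.
  by have -> : (m.+1 + `|r| - `|(r - m.+1%:Z)%R|
             = m + `|r| - `|(r - m%:Z)%R|)%N by lia.
case: q => m; first exact: xP.
by have := yP m.+1; rewrite NegzE abszN addrC.
Qed.

Hypothesis phi_neq0 : phi != 0.

Lemma weight_neq0 q : weight q != 0.
Proof.
case: q => [m|m]; first exact: oner_neq0.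
rewrite /weight; elim: m.+1 => [|n IH]; first exact: oner_neq0.
by rewrite mulf_neq0 ?tau_eq0.
Qed.

(** A coboundary is a cocycle, once the weight of x_(q+r+s) is cancelled; this
    is where phi must be nonzero and K a domain. *)
Lemma twist_cocycle q r s :
  twist q r * twist (q + r) s = tau q (twist r s) * twist q (r + s).
Proof.
apply: (mulIf (weight_neq0 (q + r + s))).
rewrite -mulrA -weightD mulrA -weightD -mulrA -tau_tau -rmorphM weightD.
by rewrite rmorphM mulrCA weightD mulrA addrA.
Qed.

End Model.

(** * A concrete generalized Weyl algebra over a domain *)

(** The carrier is the free left K[z]-module on the x_q: [<< a *g q >>] stands
    for a(z) x_q.  The hypothesis on phi is a parameter because the product is
    associative only under it. *)
Definition gwa (K : idomainType) (h : K) (phi : {poly K}) (phi_neq0 : phi != 0)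
  : Type := {malg {poly K}[int]}.

Section GwaRing.
Variables (K : idomainType) (h : K) (phi : {poly K}) (phi_neq0 : phi != 0).
Local Notation M := (gwa h phi_neq0).
Local Notation tau := (tau h).
Local Notation twist := (twist h phi).

HB.instance Definition _ := GRing.Zmodule.copy M {malg {poly K}[int]}.

Definition gwa_mul (u v : M) : M :=
  extend (fun q a => extend (fun r b => << a * tau q b * twist q r *g q + r >>) v) u.

Let mulD1 q (a : {poly K}) : forall r,
  {morph (fun b => << a * tau q b * twist q r *g q + r >>) : b c / b + c}.
Proof. by move=> r b c; rewrite rmorphD mulrDr mulrDl monalgUD. Qed.

Let mulD2 (v : M) : forall q,
  {morph (fun a => extend (fun r b => << a * tau q b * twist q r *g q + r >>) v)
    : a b / a + b}.
Proof.
move=> q a b; rewrite /extend -big_split /=; apply: eq_bigr => r _.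
by rewrite !mulrDl monalgUD.
Qed.

Lemma gwa_mulUU q r (a b : {poly K}) :
  gwa_mul << a *g q >> << b *g r >> = << a * tau q b * twist q r *g q + r >>.
Proof. by rewrite /gwa_mul extendU // extendU. Qed.

Lemma gwa_mulDl : left_distributive gwa_mul +%R.
Proof. by move=> u v w; rewrite /gwa_mul extendD. Qed.

Lemma gwa_mulDr : right_distributive gwa_mul +%R.
Proof.
move=> u v w; rewrite /gwa_mul {1 3 5}/extend -big_split /=.
by apply: eq_bigr => q _; rewrite extendD.
Qed.

Lemma gwa_mulA : associative gwa_mul.
Proof.
move=> u v w; move: u; apply: malg_morph_eq => [u u'|u u'|q a].
- by rewrite gwa_mulDl.
- by rewrite !gwa_mulDl.
move: v; apply: malg_morph_eq => [v v'|v v'|r b].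
- by rewrite gwa_mulDl gwa_mulDr.
- by rewrite gwa_mulDr gwa_mulDl.
move: w; apply: malg_morph_eq => [w w'|w w'|s c].
- by rewrite !gwa_mulDr.
- by rewrite gwa_mulDr.
rewrite !gwa_mulUU addrA; congr << _ *g _ >>.
rewrite !rmorphM /= tau_tau -!mulrA; do 2!congr (_ * _).
rewrite [RHS]mulrCA; congr (_ * _).
by rewrite [RHS]twist_cocycle.
Qed.

Lemma gwa_mul1r : left_id << 1 *g 0 >> gwa_mul.
Proof.
apply: malg_morph_eq => [u v|u v|q a]; rewrite ?gwa_mulDr //.
by rewrite gwa_mulUU mul1r tau0 twist0 mulr1 add0r.
Qed.

Lemma gwa_mulr1 : right_id << 1 *g 0 >> gwa_mul.
Proof.
apply: malg_morph_eq => [u v|u v|q a]; rewrite ?gwa_mulDl //.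
by rewrite gwa_mulUU rmorph1 twistx0 !mulr1 addr0.
Qed.

Lemma gwa_1neq0 : (<< 1 *g 0 >> : M) != 0.
Proof. by rewrite monalgU_eq0 oner_neq0. Qed.

HB.instance Definition _ := GRing.Zmodule_isNzRing.Build M
  gwa_mulA gwa_mul1r gwa_mulr1 gwa_mulDl gwa_mulDr gwa_1neq0.

Lemma mulUU q r (a b : {poly K}) : (<< a *g q >> : M) * << b *g r >>
  = << a * tau q b * twist q r *g q + r >>.
Proof. exact: gwa_mulUU. Qed.

Lemma mul0U r (a b : {poly K}) :
  (<< a *g 0 >> : M) * << b *g r >> = << a * b *g r >>.
Proof. by rewrite mulUU tau0 twist0 mulr1 add0r. Qed.

(** Scalars from K act through the constant polynomials; the carrier itself is
    only a module over [{poly K}]. *)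
Definition gwa_scale (a : K) (u : M) : M := (a%:P : {poly K}) *: (u : {malg _[_]}).

Lemma gwa_scaleU a q p : gwa_scale a << p *g q >> = << a *: p *g q >>.
Proof.
by apply/malgP => r; rewrite mcoeffZ !mcoeffU mulrnAr mul_polyC.
Qed.

Lemma gwa_scaleA a b u : gwa_scale a (gwa_scale b u) = gwa_scale (a * b) u.
Proof. by rewrite /gwa_scale scalerA polyCM. Qed.
Lemma gwa_scale1 : left_id 1 gwa_scale.
Proof. by move=> u; rewrite /gwa_scale scale1r. Qed.
Lemma gwa_scaleDr : right_distributive gwa_scale +%R.
Proof. by move=> a u v; rewrite /gwa_scale scalerDr. Qed.
Lemma gwa_scaleDl u : {morph gwa_scale^~ u : a b / a + b}.
Proof. by move=> a b; rewrite /gwa_scale polyCD scalerDl. Qed.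

HB.instance Definition _ := GRing.Zmodule_isLmodule.Build K M
  gwa_scaleA gwa_scale1 gwa_scaleDr gwa_scaleDl.

Lemma scaleU (a : K) q p : a *: (<< p *g q >> : M) = << a *: p *g q >>.
Proof. exact: gwa_scaleU. Qed.

Lemma mcoeff_scale (a : K) (u : M) q : (a *: u)@_q = a *: u@_q.
Proof. by rewrite [LHS]mcoeffZ mul_polyC. Qed.

Lemma gwa_scaleAl (a : K) (u v : M) : a *: (u * v) = (a *: u) * v.
Proof.
move: u; apply: malg_morph_eq => [u u'|u u'|q p].
- by rewrite mulrDl scalerDr.
- by rewrite scalerDr mulrDl.
move: v; apply: malg_morph_eq => [v v'|v v'|r p'].
- by rewrite mulrDr scalerDr.
- by rewrite mulrDr.
by rewrite scaleU !mulUU scaleU !scalerAl.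
Qed.

Lemma gwa_scaleAr (a : K) (u v : M) : a *: (u * v) = u * (a *: v).
Proof.
move: u; apply: malg_morph_eq => [u u'|u u'|q p].
- by rewrite mulrDl scalerDr.
- by rewrite mulrDl.
move: v; apply: malg_morph_eq => [v v'|v v'|r p'].
- by rewrite mulrDr scalerDr.
- by rewrite scalerDr mulrDr.
by rewrite scaleU !mulUU scaleU tauZ -!scalerAr -scalerAl.
Qed.

HB.instance Definition _ := GRing.Lmodule_isLalgebra.Build K M gwa_scaleAl.
HB.instance Definition _ := GRing.Lalgebra_isAlgebra.Build K M gwa_scaleAr.

End GwaRing.

Section ModelGenerators.
Variables (k : fieldType) (h : k) (phi : {poly k}) (phi_neq0 : phi != 0).
Local Notation M := (gwa h phi_neq0).

Definition gx : M := << 1 *g 1 >>.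
Definition gy : M := << 1 *g -1 >>.
Definition gz : M := << 'X *g 0 >>.

Lemma gwa_oneE : (1 : M) = << 1 *g 0 >>. Proof. by []. Qed.

Lemma horner_gz p : horner_alg gz p = << p *g 0 >>.
Proof.
elim/poly_ind: p => [|p c IH]; first by rewrite rmorph0 monalgU0.
rewrite rmorphD rmorphM /= horner_algX horner_algC IH mul0U.
by rewrite gwa_oneE scaleU alg_polyC -monalgUD.
Qed.

Lemma xpow_model q : xpow gx gy q = << 1 *g q >>.
Proof.
have nE (e : int) (m : nat) : (forall i : nat, twist h phi e (e * i%:Z) = 1) ->
    (<< 1 *g e >> : M) ^+ m = << 1 *g e * m%:Z >>.
  move=> tw; elim: m => [|m IH]; first by rewrite expr0 mulr0.
  by rewrite exprS IH mulUU rmorph1 !mul1r tw -{1}[e]mulr1 -mulrDr.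
case: q => m; rewrite /xpow nE.
- by rewrite mul1r.
- by move=> i; rewrite mul1r (twist_pos _ _ 1).
- by rewrite mulN1r NegzE.
- by move=> i; rewrite mulN1r (twist_neg _ _ 1).
Qed.

Lemma monomialE q p : (<< p *g q >> : M) = horner_alg gz p * xpow gx gy q.
Proof. by rewrite horner_gz xpow_model mul0U mulr1. Qed.

Lemma model_relations : gwa_relations h phi gx gy gz.
Proof.
have A a : a%:A = << a%:P *g 0 >> :> M.
  by rewrite gwa_oneE scaleU alg_polyC.
split; rewrite ?horner_gz ?A.
- rewrite -monalgUD mul0U mulUU mul1r mulr1 twistx0 mulr1 addr0.
  by rewrite tauX mulr1z.
- rewrite -monalgUB mul0U mulUU mul1r mulr1 twistx0 mulr1 addr0.
  by rewrite tauX mulrN1z polyCN.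
- by rewrite mulUU rmorph1 !mul1r /twist /= rmorph1 mul1r.
- by rewrite mulUU rmorph1 !mul1r /twist /= rmorph1 mul1r.
Qed.

End ModelGenerators.

Lemma xpowN (k : fieldType) (A : algType k) (x y : A) (m : nat) :
  xpow x y (- m%:Z) = y ^+ m.
Proof. by case: m. Qed.

Lemma horner_alg_morph (k : fieldType) (A B : algType k) (f : {lrmorphism A -> B})
  (z : A) p : f (horner_alg z p) = horner_alg (f z) p.
Proof.
elim/poly_ind: p => [|p c IH]; first by rewrite !rmorph0.
rewrite !rmorphD !rmorphM /= !horner_algX !horner_algC IH.
by rewrite linearZ rmorph1.
Qed.

(** * The presented algebra and its model *)

Section Relations.
Variables (k : fieldType) (eta : k) (phi : {poly k}).
Variables (A : algType k) (x y z : A).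
Hypothesis rel : gwa_relations eta phi x y z.
Local Notation tau := (tau eta).
Local Notation "p '%z'" := (horner_alg z p) (at level 2).

Lemma horner_alg_MX (a : {poly k}) (b c : k) :
  (a * ('X + b%:P) + c%:P)%z = a%z * (z + b%:A) + c%:A.
Proof. by rewrite !rmorphD rmorphM rmorphD /= horner_algX !horner_algC. Qed.

Lemma commute_horner (w : A) q :
  w * z = (z + (eta *~ q)%:A) * w -> forall p, w * p%z = (tau q p)%z * w.
Proof.
move=> wz; elim/poly_ind => [|p c IH]; first by rewrite !rmorph0 mulr0 mul0r.
have -> : tau q (p * 'X + c%:P) = tau q p * ('X + (eta *~ q)%:P) + c%:P.
  by rewrite rmorphD rmorphM /= tauX /tau comp_polyC.
have -> : p * 'X = p * ('X + 0%:P) by rewrite addr0.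
rewrite !horner_alg_MX scale0r addr0 mulrDr mulrDl mulrA IH -!mulrA wz.
by rewrite -scalerAl -scalerAr mul1r mulr1.
Qed.

Lemma x_horner p : x * p%z = (tau 1 p)%z * x.
Proof. by case: rel => xz _ _ _; apply: commute_horner; rewrite mulr1z. Qed.

Lemma y_horner p : y * p%z = (tau (-1) p)%z * y.
Proof.
by case: rel => _ yz _ _; apply: commute_horner; rewrite mulrN1z scaleNr.
Qed.

Lemma xpow_horner q p : xpow x y q * p%z = (tau q p)%z * xpow x y q.
Proof.
have xm m p' : x ^+ m * p'%z = (tau m%:Z p')%z * x ^+ m.
  elim: m p' => [|m IH] p'; first by rewrite expr0 tau0 mul1r mulr1.
  by rewrite exprSr -mulrA x_horner mulrA IH tau_tau -mulrA addrC -intS.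
have ym m p' : y ^+ m * p'%z = (tau (- m%:Z) p')%z * y ^+ m.
  elim: m p' => [|m IH] p'; first by rewrite expr0 oppr0 tau0 mul1r mulr1.
  by rewrite exprSr -mulrA y_horner mulrA IH tau_tau -mulrA addrC -opprD -intS.
by case: q => m; rewrite /xpow ?NegzE.
Qed.

Lemma x_xpow r : x * xpow x y r = (xstep eta phi r)%z * xpow x y (r + 1).
Proof.
case: rel => _ _ _ xy; case: r => r.
  by rewrite /xstep /= rmorph1 mul1r -exprS addn1.
have -> : Negz r + 1 = - r%:Z by lia.
by rewrite xpowN [xpow _ _ _]/= exprS mulrA xy.
Qed.

Lemma y_xpow r : y * xpow x y r = (ystep phi r)%z * xpow x y (r - 1).
Proof.
case: rel => _ _ yx _; case: r => [[|r]|r].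
- by rewrite /ystep /= rmorph1 mul1r mulr1.
- have -> : r.+1%:Z - 1 = r by lia.
  by rewrite [xpow _ _ r.+1]/= exprS mulrA yx.
- have -> : Negz r - 1 = Negz r.+1 by lia.
  by rewrite /ystep /= rmorph1 mul1r [RHS]exprS.
Qed.

(** The relations alone force the multiplication table of the x_q; hence the
    model maps to every algebra in which they hold. *)
Lemma xpowM q r :
  xpow x y q * xpow x y r = (twist eta phi q r)%z * xpow x y (q + r).
Proof.
have xm m : x ^+ m * xpow x y r = (xtwist eta phi m r)%z * xpow x y (m%:Z + r).
  elim: m => [|m IH]; first by rewrite expr0 rmorph1 add0r.
  rewrite exprS -mulrA IH mulrA x_horner -mulrA x_xpow mulrA -rmorphM.
  congr (_ * xpow _ _ _); lia.
have ym m : y ^+ m * xpow x y r = (ytwist eta phi m r)%z * xpow x y (r - m%:Z).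
  elim: m => [|m IH]; first by rewrite expr0 rmorph1 subr0.
  rewrite exprS -mulrA IH mulrA y_horner -mulrA y_xpow mulrA -rmorphM.
  congr (_ * xpow _ _ _); lia.
by case: q => m; rewrite ?NegzE ?[- _ + r]addrC -?xm // xpowN -ym.
Qed.

End Relations.

Section Lift.
Variables (k : fieldType) (eta : k) (phi : {poly k}) (phi_neq0 : phi != 0).
Variables (A : algType k) (x y z : A).
Local Notation M := (gwa eta phi_neq0).

(** The relations are an argument, so that the algebra morphism structure
    proved from them can be attached to this map. *)
Definition gwa_lift of gwa_relations eta phi x y z : M -> A :=
  extend (fun q p => horner_alg z p * xpow x y q).

Hypothesis rel : gwa_relations eta phi x y z.
Local Notation lift := (gwa_lift rel).

Lemma gwa_liftU q p : lift << p *g q >> = horner_alg z p * xpow x y q.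
Proof. by apply: extendU => r a b; rewrite rmorphD mulrDl. Qed.

Lemma gwa_liftD : {morph lift : u v / u + v}.
Proof. by apply: extendD => r a b; rewrite rmorphD mulrDl. Qed.

Lemma gwa_lift_linear : linear lift.
Proof.
move=> a u v; rewrite gwa_liftD; congr (_ + _).
move: u; apply: malg_morph_eq => [u u'|u u'|q p].
- by rewrite scalerDr gwa_liftD.
- by rewrite gwa_liftD scalerDr.
- by rewrite scaleU !gwa_liftU linearZ /= mulr_algl scalerAl.
Qed.
HB.instance Definition _ := GRing.isLinear.Build k M A _ lift gwa_lift_linear.

Lemma gwa_lift_monoid : monoid_morphism lift.
Proof.
split=> [|u v]; first by rewrite gwa_oneE gwa_liftU rmorph1 mulr1.
move: u; apply: malg_morph_eq => [u u'|u u'|q p].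
- by rewrite mulrDl raddfD.
- by rewrite raddfD mulrDl.
move: v; apply: malg_morph_eq => [v v'|v v'|r p'].
- by rewrite mulrDr raddfD.
- by rewrite raddfD mulrDr.
rewrite mulUU !gwa_liftU !rmorphM /= -!mulrA; congr (_ * _).
by rewrite [RHS]mulrA (xpow_horner rel) -[RHS]mulrA (xpowM rel).
Qed.
HB.instance Definition _ := GRing.isMonoidMorphism.Build M A lift gwa_lift_monoid.

(** Uniqueness in the universal property makes the composite on [A] the
    identity; the other composite is computed on monomials. *)
Lemma gwa_iso : is_gwa eta phi x y z ->
  exists f : {lrmorphism A -> M}, [/\ cancel f lift, cancel lift f
    & [/\ f x = gx eta phi_neq0, f y = gy eta phi_neq0 & f z = gz eta phi_neq0]].
Proof.
case=> _ univ; have [f [[fx fy fz] _]] := univ _ _ _ _ (model_relations eta phi_neq0).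
have [e [_ eU]] := univ _ _ _ _ rel.
exists f; split=> //.
  move=> u; transitivity (e u); last first.
    by symmetry; apply: (eU idfun).
  apply: (eU (lift \o f)); rewrite /= fx fy fz /gx /gy /gz !gwa_liftU.
  by rewrite !rmorph1 !mul1r horner_algX mulr1.
apply: malg_morph_eq => [u v|//|q p]; first by rewrite !raddfD.
rewrite gwa_liftU rmorphM monomialE; congr (_ * _).
  by rewrite /= horner_alg_morph fz.
by case: q => m; rewrite /xpow rmorphXn /= ?fx ?fy.
Qed.

End Lift.

(** * Uniqueness of a cochain with prescribed coboundary *)

Section Uniqueness.
Variables (k : fieldType) (eta : k) (phi : {poly k}) (A : algType k).
Variables (x y z : A).
Hypothesis rel : gwa_relations eta phi x y z.
Hypothesis span : forall Q : A -> Prop, Q 0 ->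
  (forall u v, Q u -> Q v -> Q (u + v)) ->
  (forall q p, Q (horner_alg z p * xpow x y q)) -> forall a, Q a.

Lemma horner_linear (F : {bilinear A -> A -> A}) : cond_b x y z F ->
  forall p u v, F (horner_alg z p * u) v = horner_alg z p * F u v.
Proof.
move=> [Fz _] p u v; elim/poly_ind: p u => [|p c IH] u.
  by rewrite rmorph0 !mul0r linear0l.
rewrite !rmorphD !rmorphM /= horner_algX horner_algC !mulrDl -!mulrA linearDl.
by rewrite IH Fz -!scalerAl !mul1r linearZl_LR.
Qed.

(** F(p(z), v) = p(z) F(1, v), and F is normalized. *)
Lemma horner_vanish (F : {bilinear A -> A -> A}) : cond_a F -> cond_b x y z F ->
  forall p v, F (horner_alg z p) v = 0.
Proof.
move=> Fa Fb p v; rewrite -[horner_alg z p]mulr1 horner_linear //.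
by case: (Fa 1 v) => _ ->; rewrite mulr0.
Qed.

Variables F G : {bilinear A -> A -> A}.
Hypothesis FG_b : forall a b c, hochschild_b F a b c = hochschild_b G a b c.
Hypotheses (Fa : cond_a F) (Ga : cond_a G).
Hypotheses (Fb : cond_b x y z F) (Gb : cond_b x y z G).

(** The coboundary relation at (a, b, c) has four terms; agreement on three of
    them gives the fourth. *)
Let right a b c : F b c = G b c -> F (a * b) c = G (a * b) c ->
  F a b = G a b -> F a (b * c) = G a (b * c).
Proof.
have := FG_b a b c; rewrite /hochschild_b => E E1 E2 E3.
by move: E; rewrite E1 E2 E3 => /addIr /addrI.
Qed.

Let left a b c : F b c = G b c -> F a (b * c) = G a (b * c) ->
  F a b = G a b -> F (a * b) c = G (a * b) c.
Proof.
have := FG_b a b c; rewrite /hochschild_b => E E1 E2 E3.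
by move: E; rewrite E1 E2 E3 => /addIr /addIr /addrI /oppr_inj.
Qed.

Let horner p v : F (horner_alg z p) v = G (horner_alg z p) v.
Proof. by rewrite !horner_vanish. Qed.

(** For w = x or w = y: the set of v on which F(w, v) = G(w, v) is stable under
    left multiplication by z, since F(w, z v) is determined by the coboundary
    and by F(w z, v) = F((z + e) w, v), which is (z + e) F(w, v). *)
Let generator w e : w * z = (z + e%:A) * w -> F w z = G w z ->
  (forall q, F w (xpow x y q) = G w (xpow x y q)) -> forall v, F w v = G w v.
Proof.
move=> wz Ewz Eq; apply: span => [|u v Eu Ev|q p]; first by rewrite !linear0r.
  by rewrite !linearDr Eu Ev.
elim/poly_ind: p => [|p c IH]; first by rewrite rmorph0 mul0r !linear0r.
rewrite !rmorphD !rmorphM /= horner_algX horner_algC mulrDl !linearDr.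
rewrite -scalerAl mul1r !linearZr_LR Eq; congr (_ + _).
have -> : horner_alg z p * z = z * horner_alg z p.
  by rewrite -{2}(horner_algX z) -rmorphM mulrC rmorphM /= horner_algX.
rewrite -mulrA; apply: right => //.
  by rewrite -(horner_algX z) horner.
set v := _ * xpow _ _ _ in IH *.
have zE : z + e%:A = horner_alg z ('X + e%:P).
  by rewrite rmorphD /= horner_algX horner_algC.
by rewrite wz zE !horner_linear // IH.
Qed.

(** In the left argument the elements a with F(a, .) = G(a, .) are closed under
    products and under left multiplication by z, so only a = x and a = y
    matter.  In the right argument x_q reduces to one generator times a power:
    F(x, y y^m) is governed by F(y, y^m) = 0, by F(x y, y^m), where x y is a
    polynomial in z, and by F(x, y). *)
Lemma cochain_unique : F x z = G x z -> F y z = G y z ->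
  F x y = G x y -> F y x = G y x -> forall u v, F u v = G u v.
Proof.
move=> Exz Eyz Exy Eyx.
have [xz yz yx xy] := rel.
have Fx : forall v, F x v = G x v.
  apply: (@generator _ eta) => // -[m|m].
    by case: Fb => _ /(_ 1%N m)[-> _]; case: Gb => _ /(_ 1%N m)[-> _].
  rewrite [xpow _ _ _]exprS; apply: right => //; last by rewrite xy horner.
  by case: Fb => _ /(_ 1%N m)[_ ->]; case: Gb => _ /(_ 1%N m)[_ ->].
have Fy : forall v, F y v = G y v.
  apply: (@generator _ (- eta)) => //; first by rewrite scaleNr.
  case=> m; last first.
    by case: Fb => _ /(_ 1%N m.+1)[_ ->]; case: Gb => _ /(_ 1%N m.+1)[_ ->].
  case: m => [|m]; first by case: (Fa y 1) => -> _; case: (Ga y 1).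
  rewrite [xpow _ _ _]exprS; apply: right => //; last by rewrite yx horner.
have Fpow w : (forall v, F w v = G w v) -> forall m v, F (w ^+ m) v = G (w ^+ m) v.
  move=> Fw; elim=> [|m IH] v; last by rewrite exprS; apply: left.
  by rewrite expr0 (Fa 1 v).2 (Ga 1 v).2.
move=> u v; move: u; apply: span => [|u w Eu Ew|q p]; first by rewrite !linear0l.
  by rewrite !linearDl Eu Ew.
rewrite !horner_linear //; congr (_ * _).
by case: q => m; apply: Fpow.
Qed.

End Uniqueness.

(** * The product with parameter [eta - t], expanded in powers of t *)

Section Coefficientwise.
Variables (I : choiceType) (G H : zmodType) (f : {additive G -> H}).

Definition malg_map (u : {malg G[I]}) : {malg H[I]} :=
  extend (fun i a => << f a *g i >>) u.

Let fD (i : I) : {morph (fun a => << f a *g i >>) : a b / a + b}.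
Proof. by move=> a b; rewrite raddfD monalgUD. Qed.

Lemma malg_mapD : {morph malg_map : u v / u + v}.
Proof. exact: extendD fD. Qed.

Lemma malg_mapU i a : malg_map << a *g i >> = << f a *g i >>.
Proof. exact: extendU fD i a. Qed.

Lemma mcoeff_map u i : (malg_map u)@_i = f u@_i.
Proof.
move: u; apply: malg_morph_eq => [u v|u v|j a].
- by rewrite malg_mapD mcoeffD.
- by rewrite mcoeffD raddfD.
by rewrite malg_mapU !mcoeffU raddfMn.
Qed.

Lemma malg_map_zmod : zmod_morphism malg_map.
Proof.
move=> u v; apply/malgP => i.
by rewrite mcoeffB !mcoeff_map mcoeffB raddfB.
Qed.

HB.instance Definition _ :=
  GRing.isZmodMorphism.Build {malg G[I]} {malg H[I]} malg_map malg_map_zmod.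

End Coefficientwise.

Section StarProduct.
Variables (k : fieldType) (eta : k) (phi : {poly k}) (phi_neq0 : phi != 0).

Lemma phi_t_neq0 : phi^:P != 0.
Proof. by rewrite map_polyC_eq0. Qed.

Local Notation M := (gwa eta phi_neq0).
Local Notation Mt := (gwa (eta%:P - 'X) phi_t_neq0).

(** In [Mt] the scalars are K = k[t]; a coefficient is a polynomial in z over
    k[t], so t is the inner variable and [coef_t n] acts coefficientwise in
    z. *)
Definition lift_t (u : M) : Mt := malg_map (map_poly polyC) u.
Definition coef_t n (w : Mt) : M := malg_map (map_poly (coefp n)) w.
Definition drop_t n (w : Mt) : Mt := malg_map (map_poly (drop_poly n)) w.

Lemma lift_tD : {morph lift_t : u v / u + v}.
Proof. exact: malg_mapD. Qed.

Lemma coef_tD n : {morph coef_t n : u v / u + v}.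
Proof. exact: malg_mapD. Qed.

Lemma coef_t_sum n (m : nat) (w : 'I_m -> Mt) :
  coef_t n (\sum_(i < m) w i) = \sum_(i < m) coef_t n (w i).
Proof. exact: (raddf_sum (malg_map _)). Qed.

Lemma coef_tXn n i w :
  coef_t n ('X^i *: w) = if (i <= n)%N then coef_t (n - i) w else 0.
Proof.
apply/malgP => q; rewrite mcoeff_map mcoeff_scale; apply/polyP => j.
rewrite coef_map coefZ /= coefXnM ltnNge; case: leqP => _ /=.
  by rewrite mcoeff_map coef_map.
by rewrite mcoeff0 coef0.
Qed.

Lemma coef_tC n (c : k) w : coef_t n (c%:P *: w) = c *: coef_t n w.
Proof.
apply/malgP => q; rewrite mcoeff_map !mcoeff_scale mcoeff_map.
by apply/polyP => j; rewrite coef_map !coefZ coef_map /= coefCM.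
Qed.

Lemma lift_tZ (c : k) u : lift_t (c *: u) = c%:P *: lift_t u.
Proof.
apply/malgP => q; rewrite mcoeff_map !mcoeff_scale mcoeff_map.
by apply/polyP => j; rewrite coef_map !coefZ coef_map /= polyCM.
Qed.

(** An element of [Mt] is a polynomial in t with coefficients in [M], written
    here with remainder.  As the product of [Mt] is k[t]-bilinear, this reduces
    the coefficients of a triple product to those of products of two lifts. *)
Lemma taylor_t n w :
  w = \sum_(i < n) 'X^i *: lift_t (coef_t i w) + 'X^n *: drop_t n w.
Proof.
apply/malgP => q; rewrite mcoeffD raddf_sum mcoeff_scale mcoeff_map /=.
apply/polyP => j; rewrite coefD coef_sum coefZ coef_map /=.
rewrite -[LHS](poly_take_drop n) mulrC addrC [RHS]addrC; congr (_ + _).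
rewrite /take_poly poly_def; apply: eq_bigr => i _.
by rewrite mcoeff_scale coefZ !mcoeff_map !coef_map /= -mul_polyC mulrC.
Qed.

Definition star n (u v : M) : M := coef_t n (lift_t u * lift_t v).

Lemma starDl n v : {morph star n ^~ v : u u' / u + u'}.
Proof. by move=> u u'; rewrite /star lift_tD mulrDl coef_tD. Qed.

Lemma starDr n u : {morph star n u : v v' / v + v'}.
Proof. by move=> v v'; rewrite /star lift_tD mulrDr coef_tD. Qed.

Lemma coef_mul_lift n w v :
  coef_t n (w * lift_t v) = \sum_(i < n.+1) star (n - i) (coef_t i w) v.
Proof.
rewrite {1}[w](taylor_t n.+1) mulrDl coef_tD -scalerAl coef_tXn ltnn addr0.
rewrite mulr_suml coef_t_sum; apply: eq_bigr => i _.
by rewrite -scalerAl coef_tXn -ltnS ltn_ord.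
Qed.

Lemma coef_lift_mul n u w :
  coef_t n (lift_t u * w) = \sum_(i < n.+1) star (n - i) u (coef_t i w).
Proof.
rewrite {1}[w](taylor_t n.+1) mulrDr coef_tD -scalerAr coef_tXn ltnn addr0.
rewrite mulr_sumr coef_t_sum; apply: eq_bigr => i _.
by rewrite -scalerAr coef_tXn -ltnS ltn_ord.
Qed.

(** The coefficient of t^n in (u v) w = u (v w). *)
Lemma star_assoc n u v w :
  \sum_(i < n.+1) star (n - i) (star i u v) w
  = \sum_(i < n.+1) star (n - i) u (star i v w).
Proof.
transitivity (coef_t n (lift_t u * lift_t v * lift_t w)).
  rewrite coef_mul_lift; apply: eq_bigr => i _.
  by rewrite [star i u v]/star.
have <- := mulrA (lift_t u) (lift_t v) (lift_t w).
rewrite coef_lift_mul; apply: eq_bigr => i _.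
by rewrite [star i v w]/star.
Qed.

Lemma star_bilinear n : bilinear_for *:%R *:%R (star n).
Proof.
split=> [v a u u'|u a v v']; rewrite ?starDl ?starDr /star lift_tZ.
  by rewrite -scalerAl coef_tC.
by rewrite -scalerAr coef_tC.
Qed.

Local Notation taut := (tau (eta%:P - 'X)).
Local Notation twistt := (twist (eta%:P - 'X) phi^:P).

Lemma starUU n q r (a b : {poly k}) :
  star n << a *g q >> << b *g r >>
  = << map_poly (coefp n) (a^:P * taut q b^:P * twistt q r) *g q + r >>.
Proof. by rewrite /star /lift_t /coef_t !malg_mapU mulUU malg_mapU. Qed.

Lemma coefp0_comp (a b : {poly {poly k}}) :
  map_poly (coefp 0) (a \Po b) = map_poly (coefp 0) a \Po map_poly (coefp 0) b.
Proof. exact: map_comp_poly. Qed.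

Lemma coefp0M (a b : {poly {poly k}}) :
  map_poly (coefp 0) (a * b) = map_poly (coefp 0) a * map_poly (coefp 0) b.
Proof. exact: rmorphM. Qed.

Lemma coefp0_polyC (a : {poly k}) : map_poly (coefp 0) a^:P = a.
Proof. by apply/polyP => i; rewrite !coef_map /= coefC. Qed.

Lemma tau_t0 q (a : {poly {poly k}}) :
  map_poly (coefp 0) (taut q a) = tau eta q (map_poly (coefp 0) a).
Proof.
rewrite /tau coefp0_comp map_polyXaddC; congr (_ \Po ('X + _%:P)).
by rewrite raddfMz /= coefB coefC coefX subr0.
Qed.

(** Setting t = 0 is a ring morphism taking [eta - t] to [eta]. *)
Lemma twist_t0 q r : map_poly (coefp 0) (twistt q r) = twist eta phi q r.
Proof.
have xs s : map_poly (coefp 0) (xstep (eta%:P - 'X) phi^:P s) = xstep eta phi s.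
  by rewrite /xstep; case: ifP; rewrite ?rmorph1 // tau_t0 coefp0_polyC.
have ys s : map_poly (coefp 0) (ystep phi^:P s) = ystep phi s.
  by rewrite /ystep; case: ifP; rewrite ?rmorph1 // coefp0_polyC.
case: q => m; rewrite /twist.
  elim: m => [|m IH]; first exact: rmorph1.
  by rewrite [RHS]/= -IH -xs -tau_t0 -coefp0M.
elim: m.+1 => [|n IH]; first exact: rmorph1.
by rewrite [RHS]/= -IH -ys -tau_t0 -coefp0M.
Qed.

Lemma star0 u v : star 0 u v = u * v.
Proof.
move: u; apply: malg_morph_eq => [u u'|u u'|q a].
- by rewrite starDl.
- by rewrite mulrDl.
move: v; apply: malg_morph_eq => [v v'|v v'|r b].
- by rewrite starDr.
- by rewrite mulrDr.
by rewrite starUU mulUU !coefp0M twist_t0 tau_t0 !coefp0_polyC.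
Qed.

Lemma coefp_polyC n (p : {poly k}) : (0 < n)%N -> map_poly (coefp n) p^:P = 0.
Proof.
move=> n0; apply/polyP => i; rewrite !coef_map coef0 /= coefC.
by case: n n0.
Qed.

(** When the structure constant is 1 the product of the lifts is the lift of
    the product, without higher powers of t. *)
Lemma star_mono1 n q (a : {poly k}) r :
  twistt q r = 1 -> (0 < n)%N -> star n << a *g q >> << 1 *g r >> = 0.
Proof.
by move=> tw n0; rewrite starUU tw !rmorph1 !mulr1 coefp_polyC // monalgU0.
Qed.

Lemma star_u1 n u : (0 < n)%N -> star n u 1 = 0.
Proof.
move=> n0; rewrite gwa_oneE; move: u; apply: malg_morph_eq => [u u'|u u'|q a].
- by rewrite starDl.
- by rewrite addr0.
by rewrite star_mono1 // twistx0.
Qed.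

Lemma coefpCM n (p : {poly k}) (w : {poly {poly k}}) :
  map_poly (coefp n) (p^:P * w) = p * map_poly (coefp n) w.
Proof.
apply/polyP => i; rewrite coef_map !coefM raddf_sum.
by apply: eq_bigr => j _; rewrite !coef_map /= coefCM.
Qed.

Lemma star_left n (p : {poly k}) u v :
  star n ((<< p *g 0 >> : M) * u) v = (<< p *g 0 >> : M) * star n u v.
Proof.
move: u; apply: malg_morph_eq => [u u'|u u'|q a].
- by rewrite mulrDr starDl.
- by rewrite starDl mulrDr.
move: v; apply: malg_morph_eq => [v v'|v v'|r b].
- by rewrite starDr.
- by rewrite starDr mulrDr.
rewrite mul0U !starUU mul0U -coefpCM; congr << map_poly _ _ *g _ >>.
by rewrite -!mulrA [X in X * _ = _]rmorphM -mulrA.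
Qed.

Lemma star_1v n v : (0 < n)%N -> star n 1 v = 0.
Proof.
move=> n0; rewrite gwa_oneE; move: v; apply: malg_morph_eq => [v v'|v v'|q a].
- by rewrite starDr.
- by rewrite addr0.
by rewrite starUU twist0 tau0 rmorph1 mul1r mulr1 coefp_polyC // monalgU0.
Qed.

End StarProduct.

(** Taylor's formula for p(z - t); the divided derivative makes it valid in
    every characteristic. *)
Lemma coefp_shift (k : fieldType) n (p : {poly k}) :
  map_poly (coefp n) (p^:P \Po ('X - 'X%:P)) = (-1) ^+ n *: p^`N(n).
Proof.
elim/poly_ind: p n => [|p c IH] n.
  by rewrite map_poly0 comp_poly0 map_poly0 linear0 scaler0.
set R := p^:P \Po _ in IH *.
have -> : (p * 'X + c%:P)^:P \Po ('X - 'X%:P) = R * 'X - R * 'X%:P + c%:P%:P.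
  rewrite rmorphD rmorphM /= map_polyX map_polyC /= comp_polyD comp_polyM.
  by rewrite comp_polyX comp_polyC mulrBr.
have cX m : map_poly (coefp m) (R * 'X) = map_poly (coefp m) R * 'X.
  apply/polyP => i; rewrite [LHS]coef_map [RHS]coefMX [in RHS]coef_map /= coefMX.
  by case: ifP; rewrite ?coef0.
have cT m : map_poly (coefp m) (R * 'X%:P)
    = if m is m'.+1 then map_poly (coefp m') R else 0.
  apply/polyP => i; rewrite [LHS]coef_map.
  by case: m => [|m]; rewrite ?coef0 ?[RHS]coef_map /= coefMC coefMX.
have cC m : map_poly (coefp m) c%:P%:P = (c *+ (m == 0))%:P.
  by rewrite map_polyC /= coefC; case: eqP.
rewrite raddfD raddfB [X in X - _]cX [X in _ - X]cT [X in _ + X]cC IH.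
case: n => [|n].
  by rewrite !expr0 !scale1r subr0 !nderivn0.
rewrite IH nderivnMXaddC polyC0 addr0 exprS mulN1r scalerDr -scalerAl.
by rewrite !scaleNr addrC.
Qed.

Section StarValues.
Variables (k : fieldType) (eta : k) (phi : {poly k}) (phi_neq0 : phi != 0).
Local Notation M := (gwa eta phi_neq0).
Local Notation star := (@star k eta phi phi_neq0).
Local Notation gx := (gx eta phi_neq0).
Local Notation gy := (gy eta phi_neq0).
Local Notation gz := (gz eta phi_neq0).

(** x_q z = (z + q (eta - t)) x_q is linear in t, so only n = 1 contributes. *)
Lemma star_xpow_z n q : (0 < n)%N ->
  star n << 1 *g q >> gz = (<< 1 *g q >> : M) *~ (- q) *+ (n == 1)%N.
Proof.
move=> n0; rewrite starUU twistx0 rmorph1 mul1r mulr1 addr0 map_polyX tauX.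
rewrite -raddfMz -raddfMn; congr << _ *g _ >>.
have X0 : map_poly (coefp n) ('X : {poly {poly k}}) = 0.
  have -> : 'X = ('X : {poly k})^:P by rewrite map_polyX.
  by rewrite coefp_polyC.
rewrite raddfD [X in X + _]X0 add0r.
rewrite [LHS]map_polyC raddfMz /= coefB coefC coefX.
case: n n0 {X0} => [|[|n]] //= _; last by rewrite subr0 mul0rz.
by rewrite sub0r mulNrz mulrNz polyCN; congr (- _); apply: rmorph_int.
Qed.

Lemma star_assoc_diff n u v w :
  \sum_(0 <= i < n.+1) (star i (star (n - i) u v) w - star i u (star (n - i) v w))
  = 0.
Proof.
have := star_assoc n u v w => /eqP; rewrite -subr_eq0 -sumrB => /eqP E.
rewrite big_mkord (reindex_inj rev_ord_inj) /= -[RHS]E.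
by apply: eq_bigr => i _; rewrite subSS subKn // -ltnS.
Qed.

(** The product of x and y is phi(z + eta - t). *)
Lemma star_xy n : star n gx gy = << (-1) ^+ n *: (sigma eta phi)^`N(n) *g 0 >>.
Proof.
rewrite starUU rmorph1 mul1r; congr << _ *g _ >>.
rewrite rmorph1 mul1r /twist /= rmorph1 mul1r /xstep /= -coefp_shift.
congr map_poly; rewrite /tau /sigma mulr1z.
rewrite map_comp_poly map_polyXaddC -comp_polyA.
by rewrite comp_polyD comp_polyX comp_polyC polyCB addrAC addrA.
Qed.

Lemma star_yx n : (0 < n)%N -> star n gy gx = 0.
Proof.
move=> n0; rewrite starUU rmorph1 mul1r rmorph1 mul1r /twist /= rmorph1 mul1r.
by rewrite /ystep /= coefp_polyC // monalgU0.
Qed.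

End StarValues.

(** * The expansion as an integrating family *)

Lemma Gamma_horner_xpow (k : fieldType) (phi : {poly k}) (A : algType k) (x y z : A)
    (N : nat) (p : {poly k}) (q : int) :
  (size p + (size phi).-1.+1 * `|q| <= N.+1)%N ->
  Gamma phi x y z N (horner_alg z p * xpow x y q).
Proof.
move=> le; exists [seq (i, q) | i <- iota 0 (size p)], (fun b => p`_b.1); split.
  move=> b /mapP[i]; rewrite mem_iota /basis_norm => /andP[_ lti] -> /=.
  by rewrite -ltnS; apply: leq_trans le; rewrite ltn_add2r.
rewrite big_map -{1}[p]coefK poly_def rmorph_sum mulr_suml.
rewrite -[X in iota _ X]subn0 -/(index_iota 0 (size p)) big_mkord.
apply: eq_bigr => i _; rewrite /basis_elt /= -mul_polyC rmorphM rmorphXn /=.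
by rewrite horner_algC horner_algX mulr_algl scalerAl.
Qed.

(** The properties of the expansion that the theorem needs, in a form which
    makes sense in any algebra with three chosen elements and therefore moves
    along isomorphisms.  At n = 1 they are those of F_1. *)
Definition star_family (k : fieldType) (eta : k) (phi : {poly k})
    (A : algType k) (x y z : A) (S : nat -> A -> A -> A) : Prop :=
  [/\ forall n, bilinear_for *:%R *:%R (S n),
      forall n, (0 < n)%N -> forall a b c,
        \sum_(1 <= i < n) bullet (S i) (S (n - i)%N) a b c
        = hochschild_b (S n) a b c,
      forall n, (0 < n)%N -> cond_a (S n) /\ cond_b x y z (S n),
      forall n, (0 < n)%N -> [/\ S n x z = - x *+ (n == 1)%N,
        S n y z = y *+ (n == 1)%N,
        S n x y = (-1) ^+ n *: horner_alg z (sigma eta phi)^`N(n) & S n y x = 0]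
    & forall n, preserves_Gamma phi x y z (S n)].

Section ModelFamily.
Variables (k : fieldType) (eta : k) (phi : {poly k}) (phi_neq0 : phi != 0).
Local Notation M := (gwa eta phi_neq0).
Local Notation star := (@star k eta phi phi_neq0).
Local Notation gx := (gx eta phi_neq0).
Local Notation gy := (gy eta phi_neq0).
Local Notation gz := (gz eta phi_neq0).

(** The terms i = 0 and i = n of the associative law involve the undeformed
    product [star 0] and make up the coboundary. *)
Lemma star_cobound n u v w : (0 < n)%N ->
  \sum_(1 <= i < n) bullet (star i) (star (n - i)) u v w
  = hochschild_b (star n) u v w.
Proof.
move=> n0; have := star_assoc_diff n u v w.
rewrite big_nat_recr // big_ltn //= subn0 subnn !star0 /bullet /hochschild_b.
move: (\sum_(1 <= i < n) _) (u * star n v w) (star n (u * v) w)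
  (star n u (v * w)) (star n u v * w) => S a b c d E.
apply: (addrI (d - a)); apply: (addIr (b - c)); rewrite E !addrA subrK.
rewrite [_ - d]addrAC [d - b - d]addrAC subrr sub0r.
by rewrite [_ + c + b]addrAC addNr add0r subrr.
Qed.

Lemma star_cond_b n : (0 < n)%N -> cond_b gx gy gz (star n).
Proof.
move=> n0; split=> [u v|q j]; first exact: star_left.
have xx (m : nat) : gx ^+ m = << 1 *g m%:Z >> by rewrite -xpow_model.
have yy (m : nat) : gy ^+ m = << 1 *g - m%:Z >> by rewrite -xpow_model xpowN.
rewrite !xx !yy !star_mono1 //; first exact: twist_neg.
exact: (twist_pos _ _ q j).
Qed.

(** The product is z^i (z + q (eta - t))^j P(q, r) x_(q+r); taking a
    coefficient in t does not raise the degree in z, and the degree of P(q, r)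
    is compensated by the drop of |q| + |r| to |q + r|. *)
Lemma star_Gamma n : preserves_Gamma phi gx gy gz (star n).
Proof.
move=> [i q] [j r]; rewrite /basis_elt.
have bE (m : nat) s : gz ^+ m * xpow gx gy s = << 'X^m *g s >>.
  by rewrite monomialE rmorphXn /= horner_algX.
rewrite !bE starUU monomialE; apply: Gamma_horner_xpow; rewrite /basis_norm /=.
set p := _ * _ * _.
have le1 : (size (map_poly (coefp n) p) <= size p)%N.
  by rewrite /map_poly; apply: size_poly.
have le2 : (size p <= (i + j + (size phi).-1 * (`|q| + `|r| - `|(q + r)%R|)).+1)%N.
  have := size_twist (eta%:P - 'X) phi^:P q r.
  rewrite size_map_polyC => le3.
  apply: leq_trans (size_polyMleq _ _) _.
  have: (size (('X^i)^:P * tau (eta%:P - 'X) q ('X^j)^:P)%R <= (i + j).+1)%N.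
    apply: leq_trans (size_polyMleq _ _) _.
    by rewrite size_tau !size_map_polyC !size_polyXn addSn addnS.
  move: le3; move: (size _) (size _) (_ * _)%N => a b c; lia.
apply: leq_trans (leq_add (leq_trans le1 le2) (leqnn _)) _.
have : (`|(q + r)%R| <= `|q| + `|r|)%N by lia.
move: `|(q + r)%R|%N `|q|%N `|r|%N (size phi).-1 => a b c l; nia.
Qed.

Lemma model_family : star_family eta phi gx gy gz star.
Proof.
split.
- exact: star_bilinear.
- by move=> n n0 a b c; apply: star_cobound.
- move=> n n0; split; last exact: star_cond_b.
  by move=> u v; rewrite star_u1 // star_1v.
- move=> n n0; split.
  + by rewrite star_xpow_z // mulrN1z.
  + by rewrite star_xpow_z // opprK mulr1z.
  + by rewrite star_xy -scaleU horner_gz.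
  + exact: star_yx.
- exact: star_Gamma.
Qed.

End ModelFamily.

Section Transport.
Variables (k : fieldType) (eta : k) (phi : {poly k}) (A B : algType k).
Variables (x y z : A) (x' y' z' : B) (f : {lrmorphism A -> B}).
Variables (g : {lrmorphism B -> A}) (fK : cancel f g) (gK : cancel g f).
Hypotheses (fx : f x = x') (fy : f y = y') (fz : f z = z').

Lemma transport_family S : star_family eta phi x' y' z' S ->
  star_family eta phi x y z (fun n u v => g (S n (f u) (f v))).
Proof.
case=> Sbil Sint Sab Sval Sgam.
have gx : g x' = x by rewrite -fx fK.
have gy : g y' = y by rewrite -fy fK.
have gz : g z' = z by rewrite -fz fK.
split.
- move=> n; have [Sl Sr] := Sbil n.
  split=> [v a u u'|u a v v']; first by rewrite linearP Sl linearP.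
  by rewrite linearP Sr linearP.
- move=> n n0 a b c.
  transitivity (g (hochschild_b (S n) (f a) (f b) (f c))).
    rewrite -Sint // raddf_sum; apply: eq_bigr => i _.
    by rewrite /bullet !gK raddfB.
  by rewrite /hochschild_b raddfB raddfD raddfB /= !rmorphM /= !fK.
- move=> n n0; have [Sa [Sb1 Sb2]] := Sab n n0; split.
    move=> u v; rewrite !rmorph1; have [-> ->] := Sa (f u) (f v).
    by rewrite raddf0.
  split=> [u v|q j]; first by rewrite rmorphM /= fz Sb1 rmorphM /= gz.
  by rewrite !rmorphXn /= fx fy; have [-> ->] := Sb2 q j; rewrite raddf0.
- move=> n n0; have [E1 E2 E3 E4] := Sval n n0.
  rewrite fx fy fz E1 E2 E3 E4; split; last exact: raddf0.
  + by rewrite raddfMn raddfN /= gx.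
  + by rewrite raddfMn /= gy.
  + by rewrite linearZ /= horner_alg_morph gz.
- move=> n b1 b2.
  have fb b : f (basis_elt x y z b) = basis_elt x' y' z' b.
    rewrite /basis_elt rmorphM rmorphXn /= fz; congr (_ * _).
    by case: (b.2) => m; rewrite /= rmorphXn /= ?fx ?fy.
  have gb b : g (basis_elt x' y' z' b) = basis_elt x y z b by rewrite -fb fK.
  rewrite !fb; have [s [c [sN ->]]] := Sgam n b1 b2.
  exists s, c; split=> //; rewrite raddf_sum; apply: eq_bigr => b _.
  by rewrite /= linearZ /= gb.
Qed.

End Transport.

(** * Existence, uniqueness and compatibility with the filtration *)

(** A name for [F] carrying the proof of bilinearity, to which the structure can
    be attached. *)
Definition bilinear_fun (k : fieldType) (A : algType k) (F : A -> A -> A)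
  of bilinear_for *:%R *:%R F := F.
HB.instance Definition _ (k : fieldType) (A : algType k) (F : A -> A -> A)
    (F_bil : bilinear_for *:%R *:%R F) :=
  bilinear_isBilinear.Build k A A A *:%R *:%R (bilinear_fun F_bil) F_bil.

Lemma gwa_span (k : fieldType) (eta : k) (phi : {poly k}) (phi_neq0 : phi != 0)
    (A : algType k) (x y z : A) (A_gwa : is_gwa eta phi x y z) (Q : A -> Prop) :
  Q 0 -> (forall u v, Q u -> Q v -> Q (u + v)) ->
  (forall q p, Q (horner_alg z p * xpow x y q)) -> forall a, Q a.
Proof.
move=> Q0 QD QU a; have [rel _] := A_gwa.
have [f [fK _ _]] := gwa_iso phi_neq0 rel A_gwa.
rewrite -[a]fK; move: (f a); apply: malg_ind => [|u v Qu Qv|q p].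
- by rewrite raddf0.
- by rewrite raddfD; apply: QD.
- by rewrite gwa_liftU.
Qed.

Lemma gwa_family (k : fieldType) (eta : k) (phi : {poly k}) (phi_neq0 : phi != 0)
    (A : algType k) (x y z : A) (A_gwa : is_gwa eta phi x y z) :
  exists S, star_family eta phi x y z S.
Proof.
have [rel _] := A_gwa.
have [f [fK gK [fx fy fz]]] := gwa_iso phi_neq0 rel A_gwa.
eexists; apply: (transport_family fK gK fx fy fz).
exact: model_family.
Qed.

Lemma nderivnE_char0 (k : fieldType) (char0 : [pchar k] =i pred0) n (p : {poly k}) :
  p^`N(n) = n`!%:R^-1 *: p^`(n).
Proof.
rewrite nderivn_def -scaler_nat scalerA mulVf ?scale1r //.
by rewrite (pcharf0P _).1 // -lt0n fact_gt0.
Qed.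

Theorem theorem5p4 (k : fieldType) (char0 : [pchar k] =i pred0)
    (eta : k) (eta_neq0 : eta != 0)
    (phi : {poly k}) (phi_neq0 : phi != 0)
    (A : algType k) (x y z : A) (A_gwa : is_gwa eta phi x y z)
    (F1 : {bilinear A -> A -> A}) (F1P : is_F1 eta phi x y z F1) :
  exists F : nat -> {bilinear A -> A -> A},
    [/\ integrating_family eta phi x y z F1 F,
        (forall F' : nat -> {bilinear A -> A -> A},
           integrating_family eta phi x y z F1 F' ->
           forall n, (2 <= n)%N -> forall u v, F' n u v = F n u v)
      & forall n, (2 <= n)%N -> preserves_Gamma phi x y z (F n)].
Proof.
have [rel _] := A_gwa.
have span := gwa_span phi_neq0 A_gwa.
have [S [Sbil Sint Sab Sval Sgam]] := gwa_family phi_neq0 A_gwa.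
pose F n : {bilinear A -> A -> A} := bilinear_fun (Sbil n).
have FE n : F n = S n :> (A -> A -> A) by [].
have F1E u v : F 1%N u v = F1 u v.
  have [F1c F1a F1b [F1xz F1yz F1xy F1yx]] := F1P.
  have [S1a S1b] := Sab 1%N isT; have [Sxz Syz Sxy Syx] := Sval 1%N isT.
  apply: (cochain_unique rel span) => //.
  - by move=> a b c; rewrite F1c -(Sint 1%N) // big_geq.
  - by rewrite FE Sxz F1xz.
  - by rewrite FE Syz F1yz.
  - by rewrite FE Sxy F1xy expr1 scaleN1r nderivn1.
  - by rewrite FE Syx F1yx.
have F_int : integrating_family eta phi x y z F1 F.
  split; first by split=> // n n2 a b c; apply: Sint; apply: ltnW.
  move=> n n2; have n0 := ltnW n2.
  have [Sa Sb] := Sab n n0; have [Sxz Syz Sxy Syx] := Sval n n0.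
  have n1 : (n == 1)%N = false by case: n n2 {n0 Sa Sb Sxz Syz Sxy Syx} => [|[]].
  rewrite n1 !mulr0n in Sxz Syz.
  split=> //; split; rewrite ?FE //.
  by rewrite Sxy (nderivnE_char0 char0) linearZ /= mulr_algl scalerA.
exists F; split=> // [F' F'_int|n _]; last exact: Sgam.
have [[F_1 F_b] F_c] := F_int; have [[F'_1 F'_b] F'_c] := F'_int.
have E n : (0 < n)%N -> forall u v, F' n u v = F n u v; last first.
  by move=> n n2; apply: E; apply: ltnW.
(* All F_i with 0 < i < n agree, so F_n and F'_n have the same coboundary. *)
elim/ltn_ind: n => n IH n0.
have [n1 | n2] : n = 1%N \/ (2 <= n)%N by case: n n0 {IH} => [|[|n]]; auto.
  by move=> u v; rewrite n1 F'_1 F1E.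
have [F'a F'bb [F'xz F'yz F'xy F'yx]] := F'_c n n2.
have [Fa Fbb [Fxz Fyz Fxy Fyx]] := F_c n n2.
apply: (cochain_unique rel span) => //; rewrite ?F'xz ?F'yz ?F'xy ?F'yx //.
move=> a b c; rewrite -F'_b // -F_b //; apply: eq_big_nat => i /andP[i0 i_n].
by rewrite /bullet !IH ?subn_gt0 ?ltn_subrL ?i0.
Qed.
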